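(* Let $(A,B,C)$ be a set of $n$-sided dice. Then $(A,B,C)$ is balanced if and only if $\sum_{x\in A}x=\sum_{x\in B}x=\sum_{x\in C}x$.
   Context: Fix an integer $n>0$. A set of $n$-sided dice is an ordered triple $(A,B,C)$ of pairwise disjoint sets with $|A|=|B|=|C|=n$ and $A\cup B\cup C=\{1,2,\dots,3n\}$; each die is fair and dice are rolled independently. For dice $X,Y$, $P(X\succ Y)=\frac{1}{n^2}|\{(x,y)\in X\times Y: x>y\}|$ is the probability that the number rolled on $X$ exceeds that rolled on $Y$. The set of dice is balanced if $P(A\succ B)=P(B\succ C)=P(C\succ A)$. The sums $\sum_{x\in A}x$ etc. are called the face-sums of the dice. *)

(* Defs.v *)
From mathcomp Require Import all_boot all_order all_algebra.

Set Implicit Arguments.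
Unset Strict Implicit.
Unset Printing Implicit Defensive.

(* The labels 1, ..., 3n are the nonzero elements of 'I_(3 * n).+1, each with
   its own value as label; the element 0 belongs to no die (see is_dice). *)
Notation face n := 'I_(3 * n)%N.+1 (only parsing).

Definition is_dice (n : nat) (A B C : {set face n}) : Prop :=
  [/\ [disjoint A & B], [disjoint A & C] & [disjoint B & C]] /\
  [/\ #|A| = n, #|B| = n & #|C| = n] /\
  A :|: B :|: C = [set i : face n | (0 < i)%N].

Definition prob_gt (n : nat) (X Y : {set face n}) : rat :=
  (#|[set p : face n * face n in setX X Y | (p.1 > p.2)%N]|%:R
     / (n ^ 2)%N%:R)%R.

Definition balanced (n : nat) (A B C : {set face n}) : Prop :=
  prob_gt A B = prob_gt B C /\ prob_gt B C = prob_gt C A.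

Definition face_sum (n : nat) (X : {set face n}) : nat :=
  \sum_(x in X) (x : nat).

(* Main.v *)
Require Import Defs.
From mathcomp Require Import all_boot all_order all_algebra.
From mathcomp Require Import zify.

Set Implicit Arguments.
Unset Strict Implicit.
Unset Printing Implicit Defensive.

(** Write [g X Y] for the number of pairs in [X * Y] with [x > y]. A label [x]
    is the number of elements of [{0, ..., 3n}] below it, so summing over [x]
    in [A] gives [face_sum A = n + g A A + g A B + g A C]. Here [g A A] depends
    only on [n], and [g A C = n^2 - g C A]; hence the three face-sums are, up to
    a common constant, the cyclic differences of [g A B], [g B C], [g C A]. *)

Lemma sum_ltn_ord (m : nat) (x : 'I_m) : \sum_(y < m) (y < x) = x.
Proof.
rewrite -big_mkcond /= -(big_ord_widen m (fun=> 1) (ltnW (ltn_ord x))).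
by rewrite sum1_card card_ord.
Qed.

Section PairCount.

Variable m : nat.
Implicit Types X Y Z : {set 'I_m}.

(** A double sum of booleans rather than a cardinality, so that big-operator lemmas can split it
    over unions and swap its two indices. *)
Definition gt_count X Y : nat := \sum_(x in X) \sum_(y in Y) (y < x).

Lemma card_gt_pairs X Y :
  #|[set p : 'I_m * 'I_m in setX X Y | p.2 < p.1]| = gt_count X Y.
Proof.
rewrite /gt_count pair_big -sum1_card /= [RHS]big_mkcond [LHS]big_mkcond /=.
apply: eq_bigr => -[x y] _; rewrite !inE /=.
by case: (x \in X) (y \in Y) (y < x) => [] [] [].
Qed.

Lemma gt_countUr X Y Z :
  [disjoint Y & Z] -> gt_count X (Y :|: Z) = gt_count X Y + gt_count X Z.
Proof.
move=> dYZ; rewrite /gt_count -big_split /=; apply: eq_bigr => x _.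
by rewrite -bigU //; apply: eq_bigl => y; rewrite !inE.
Qed.

(** For each pair exactly one of [y < x], [x < y], [x = y] holds. Keeping the intersection term lets
    one identity serve both disjoint dice and the case [Y = X]. *)
Lemma gt_count_trichotomy X Y :
  gt_count X Y + gt_count Y X + #|X :&: Y| = #|X| * #|Y|.
Proof.
have -> : #|X :&: Y| = \sum_(x in X) \sum_(y in Y) (x == y).
  rewrite -sum1_card (eq_bigl (fun x => (x \in X) && (x \in Y))); last first.
    by move=> x; rewrite inE.
  rewrite big_mkcondr; apply: eq_bigr => x _; have [xY | xNY] := boolP (x \in Y).
    rewrite (bigD1 x) //= eqxx big1 // => y /andP[_ /negPf].
    by rewrite eq_sym => ->.
  rewrite big1 // => y yY; case: eqP => // xy; by rewrite xy yY in xNY.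
(* Once the second sum is reindexed, all three run over [x] in [X], then [y] in [Y], and can be
   compared pair by pair. *)
rewrite /gt_count [X in _ + X + _]exchange_big -!big_split -sum_nat_const /=.
apply: eq_bigr => x _; rewrite -!big_split -sum1_card /=.
apply: eq_bigr => y _; rewrite -val_eqE /=; by case: ltngtP.
Qed.

Lemma gt_count_disjoint X Y :
  [disjoint X & Y] -> gt_count X Y + gt_count Y X = #|X| * #|Y|.
Proof.
by rewrite -setI_eq0 -gt_count_trichotomy => /eqP->; rewrite cards0 addn0.
Qed.

Lemma gt_count_self X : (gt_count X X).*2 + #|X| = #|X| * #|X|.
Proof. by rewrite -gt_count_trichotomy setIid addnn. Qed.

End PairCount.

Section Dice.

Variable n : nat.
Implicit Types A B C X Y Z W : {set 'I_(3 * n).+1}.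

Lemma eq_prob_gt X Y Z W : 0 < n ->
  prob_gt X Y = prob_gt Z W <-> gt_count X Y = gt_count Z W.
Proof.
move=> n0; rewrite /prob_gt !card_gt_pairs; split=> [|-> //].
have n2 : ((n ^ 2)%:R != 0 :> rat)%R.
  by rewrite Num.Theory.pnatr_eq0 -lt0n expn_gt0 n0.
by move/(GRing.mulIf (GRing.Theory.invr_neq0 n2))/eqP;
  rewrite Num.Theory.eqr_nat => /eqP.
Qed.

Lemma face_sum_gt_count A B C X : is_dice A B C -> X \subset A :|: B :|: C ->
  face_sum X = #|X| + gt_count X A + gt_count X B + gt_count X C.
Proof.
move=> [[dAB dAC dBC] [_ ABC]] sX.
(* [ord0] is adjoined because it is below every face but on no die; with it the dice exhaust the
   ordinal type. *)
have -> : face_sum X = gt_count X (ord0 |: (A :|: B :|: C)).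
  apply: eq_bigr => x _; rewrite -[LHS]sum_ltn_ord; apply: eq_bigl => y.
  by rewrite ABC !inE -val_eqE /=; case: (val y).
have d0 : [disjoint [set ord0] & A :|: B :|: C] by rewrite ABC disjoints1 inE.
have dABC : [disjoint A :|: B & C] by rewrite -setI_eq0 setIUl setU_eq0 !setI_eq0 dAC.
rewrite !gt_countUr // !addnA; congr (_ + _ + _ + _).
(* Faces are positive, so each one beats [ord0] exactly once; this gives the term [#|X|]. *)
rewrite -sum1_card; apply: eq_bigr => x /(subsetP sX).
by rewrite ABC inE big_set1 /= => ->.
Qed.

End Dice.

Theorem theorem3p1 (n : nat) (A B C : {set face n}) :
  (0 < n)%N ->
  is_dice A B C ->
  balanced A B C <->
  (face_sum A = face_sum B /\ face_sum B = face_sum C).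
Proof.
move=> n0 D; rewrite /balanced !eq_prob_gt //.
have sA : A \subset A :|: B :|: C by rewrite -setUA subsetUl.
have sB : B \subset A :|: B :|: C by rewrite setUAC subsetUr.
have sC : C \subset A :|: B :|: C by rewrite subsetUr.
rewrite !(face_sum_gt_count D) //.
case: D => [[dAB dAC dBC] [[cA cB cC] _]].
have := gt_count_self A; have := gt_count_self B.
have := gt_count_self C; have := gt_count_disjoint dAB.
have := gt_count_disjoint dAC; have := gt_count_disjoint dBC.
(* The goal is linear with [n * n] as an atom. The three cyclic differences add up to zero, so they
   are all equal only if they all vanish. *)
rewrite cA cB cC; lia.
Qed.
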